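(* Let $2\le k\le n$ be integers. Then $$\mathcal{A}^{\lfloor k/2\rfloor}_{n-\lfloor\frac{k-2}{2}\rfloor}=A^{\lfloor k/2\rfloor}_{n-\lfloor\frac{k-2}{2}\rfloor},$$ that is, the incidence matrix on the left equals the recursively constructed matrix on the right.
   Context: $\mathcal{A}^{\lfloor k/2\rfloor}_{n-\lfloor\frac{k-2}{2}\rfloor}$ is the $(0,1)$-matrix with rows indexed by the $\lfloor\frac{k-2}{2}\rfloor$-element subsets $\alpha$ of $[n]=\{1,\dots,n\}$ and columns by the $\lfloor\frac k2\rfloor$-element subsets $\beta$ of $[n]$, both listed in lexicographic order (of their increasing tuples), with entry $1$ if $\alpha\subset\beta$ and $0$ otherwise. (Equivalently, writing $\Sigma_n=\{P_1,\dots,P_n\}$ for an $n$-set, it is the incidence matrix of the family $S_{P_\alpha}=\{P_\beta:\alpha\subset\beta\}$.) The matrices $A_p^q$ ($p,q\ge1$) are defined recursively: $A_p^1$ is the $1\times p$ row of ones; for $q\ge2$, $A_p^q=\mathcal P(\mathcal O(A_p^{q-1}),\mathcal O(A_{p-1}^{q-1}),\dots,\mathcal O(A_1^{q-1}))$. Here $\mathcal O(M)$ is obtained from a matrix $M$ with $m$ columns by appending the $m\times m$ identity matrix below it, and $\mathcal P(M_1,\dots,M_t)$ places the matrices side by side from left to right with bottom rows aligned, filling the empty positions above with zeros. *)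

(* Defs.v *)
From HB Require Import structures.
From mathcomp Require Import all_boot all_order all_algebra.

Set Implicit Arguments.
Unset Strict Implicit.
Unset Printing Implicit Defensive.

Import Order.TTheory GRing.Theory.
Local Open Scope ring_scope.

(* Matrices packed with their dimensions: Leibniz equality of packed matrices
   means equal dimensions and equal entries. *)
Record pmatrix (R : Type) := PMatrix {
  nrows : nat;
  ncols : nat;
  pmx : 'M[R]_(nrows, ncols)
}.

(* The set [n] is represented by 'I_n, i.e. shifted to {0, ..., n - 1}; enum B
   lists the elements of B in increasing order. *)
Definition lex_le (n : nat) (B C : {set 'I_n}) : bool :=
  ((enum B : seqlexi 'I_n) <= (enum C : seqlexi 'I_n))%O.

Definition lex_subsets (n r : nat) : seq {set 'I_n} :=
  sort (@lex_le n) (enum [set B : {set 'I_n} | #|B| == r]).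

Definition incidence (R : nzSemiRingType) (n r s : nat) : pmatrix R :=
  PMatrix (\matrix_(i < size (lex_subsets n r), j < size (lex_subsets n s))
    ((tnth (in_tuple (lex_subsets n r)) i
        \subset tnth (in_tuple (lex_subsets n s)) j)%:R : R)).

Definition incidence_nk (R : nzSemiRingType) (n k : nat) : pmatrix R :=
  incidence R n ((k - 2)./2)%N (k./2)%N.

Definition opO (R : nzSemiRingType) (M : pmatrix R) : pmatrix R :=
  PMatrix (col_mx (pmx M) 1%:M).

Definition pad_top (R : nzSemiRingType) (m h n : nat) (le_mh : (m <= h)%N)
    (M : 'M[R]_(m, n)) : 'M[R]_(h, n) :=
  castmx (subnK le_mh, erefl n) (col_mx (0 : 'M[R]_(h - m, n)) M).

Definition opP2 (R : nzSemiRingType) (M N : pmatrix R) : pmatrix R :=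
  PMatrix (row_mx (pad_top (leq_maxl (nrows M) (nrows N)) (pmx M))
                  (pad_top (leq_maxr (nrows M) (nrows N)) (pmx N))).

Definition opP (R : nzSemiRingType) (Ms : seq (pmatrix R)) : pmatrix R :=
  foldr (@opP2 R) (PMatrix (0 : 'M[R]_(0, 0))) Ms.

(* Only meaningful for p, q >= 1; the value at q = 0 is a placeholder. *)
Fixpoint Apq (R : nzSemiRingType) (p q : nat) : pmatrix R :=
  match q with
  | 0 => PMatrix (0 : 'M[R]_(0, 0))
  | q'.+1 =>
      if q' is 0 then PMatrix (const_mx 1 : 'M[R]_(1, p))
      else opP [seq opO (Apq R r q') | r <- rev (iota 1 p)]
  end.

(* Main.v *)
Require Import Defs.
From HB Require Import structures.
From mathcomp Require Import all_boot all_order all_algebra.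
From mathcomp Require Import zify.

(** Classify the subsets of an ordered set x :: s by whether they contain the
    least element x.  In lexicographic order those containing x come first, so
    the (r+1)-subsets of x :: s are the x :: t with t an r-subset of s, followed
    by the (r+1)-subsets of s; [combs] is this recursion.  Applied to both the
    rows (r+1 elements) and the columns (r+2 elements), it cuts the incidence
    matrix of x :: s into four blocks.
    - Row x :: a, column x :: b: inclusion of a in b, the incidence matrix of s
      one rank lower.
    - Row a, column x :: b: here a and b both have r+1 elements and a misses x,
      so a is included in x :: b only if a = b; this is an identity matrix.
    - Row x :: a, column b: zero, as x is not in b.
    - Row a, column b: the incidence matrix of s at the same rank.
    The first two blocks form the image under O of a smaller incidence matrix,
    and the whole is obtained from that image and the fourth block by P: this is
    the recursion defining A_p^q, whose leading term is split off the list in P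
    ([Apq_rec]).  Hence the two matrices agree by induction on the rank and then
    on p ([inclmx_combs]).

    Two facts connect this to the statement: the sorted enumeration of the
    r-subsets of [n] is [combs] of the increasing list of [n]
    ([lex_subsets_combs]), and the operations O and P act on matrices tabulated
    along two lists by concatenating the lists ([opO_seqmx], [opP2_seqmx]). *)

Set Implicit Arguments.
Unset Strict Implicit.
Unset Printing Implicit Defensive.

Import Order.TTheory GRing.Theory.
Local Open Scope ring_scope.

(** * Matrices tabulated along two lists *)

(** Comparing entries at ordinals of equal value avoids every cast between
    propositionally equal dimensions. *)
Lemma eq_PMatrix (R : Type) m n m' n' (A : 'M[R]_(m, n)) (B : 'M[R]_(m', n')) :
    m = m' -> n = n' ->
    (forall (i : 'I_m) (j : 'I_n) (i' : 'I_m') (j' : 'I_n'),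
      i = i' :> nat -> j = j' :> nat -> A i j = B i' j') ->
  PMatrix A = PMatrix B.
Proof.
move=> em en; subst m' n' => eAB.
by congr PMatrix; apply/matrixP => i j; apply: eAB.
Qed.

Lemma nth_in_tuple (T : Type) (x0 : T) xs (i : 'I_(size xs)) :
  nth x0 xs i = tnth (in_tuple xs) i.
Proof. by rewrite (tnth_nth x0). Qed.

Section SeqMx.
Variable R : nzSemiRingType.

Definition seqmx (T U : Type) (f : T -> U -> R) (xs : seq T) (ys : seq U) :
    pmatrix R :=
  PMatrix (\matrix_(i < size xs, j < size ys)
             f (tnth (in_tuple xs) i) (tnth (in_tuple ys) j)).

Lemma seqmx_map (T U T' U' : Type) (g : T' -> T) (h : U' -> U)
    (f : T -> U -> R) xs ys :
  seqmx f (map g xs) (map h ys) = seqmx (fun x y => f (g x) (h y)) xs ys.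
Proof.
apply: eq_PMatrix; rewrite ?size_map // => i j i' j' ei ej; rewrite !mxE.
set x0 := tnth (in_tuple xs) i'; set y0 := tnth (in_tuple ys) j'.
rewrite (tnth_nth (g x0)) (tnth_nth (h y0)) /= ei ej.
by rewrite (nth_map x0) // (nth_map y0) // !nth_in_tuple.
Qed.

Lemma eq_seqmx (T U : eqType) (f g : T -> U -> R) xs ys :
  {in xs & ys, f =2 g} -> seqmx f xs ys = seqmx g xs ys.
Proof.
move=> efg; congr PMatrix; apply/matrixP => i j; rewrite !mxE.
by apply: efg; apply: mem_tnth.
Qed.

(** Uniqueness of [ys] makes equality of its members the same as equality of
    positions, which is what the identity block appended by O records. *)
Lemma opO_seqmx (T : eqType) (f : T -> T -> R) xs ys :
    uniq ys -> {in ys &, forall y z, f y z = (y == z)%:R} ->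
  opO (seqmx f xs ys) = seqmx f (xs ++ ys) ys.
Proof.
move=> uys fid; apply: eq_PMatrix; rewrite ?size_cat //.
move=> i j i' j' ei ej; rewrite !mxE.
set y0 := tnth (in_tuple ys) j; set x0 := tnth _ i'.
have -> : tnth (in_tuple ys) j' = y0.
  by rewrite (tnth_nth y0) -ej nth_in_tuple.
rewrite /x0 (tnth_nth x0) /= -ei nth_cat.
case: splitP => i1 ei1; rewrite ei1.
  by rewrite mxE (tnth_nth x0).
have ey0 : y0 = nth y0 ys j by rewrite nth_in_tuple.
rewrite /= addKn (set_nth_default y0) // fid ?mem_nth ?mem_tnth //.
by rewrite mxE {2}ey0 nth_uniq.
Qed.

(** Bottom alignment places the rows of the right matrix at the suffix [xs2];
    the zeros filled in above them are the values of [f] on [xs1] and [ys2]. *)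
Lemma opP2_seqmx (T U : eqType) (f : T -> U -> R)
    (xs1 xs2 : seq T) (ys1 ys2 : seq U) :
    {in xs1 & ys2, forall x y, f x y = 0} ->
  opP2 (seqmx f (xs1 ++ xs2) ys1) (seqmx f xs2 ys2)
    = seqmx f (xs1 ++ xs2) (ys1 ++ ys2).
Proof.
move=> f0; have sz := size_cat xs1 xs2.
have eh : maxn (size (xs1 ++ xs2)) (size xs2) = size (xs1 ++ xs2) by lia.
apply: eq_PMatrix; rewrite ?size_cat // -?size_cat //.
move=> i j i' j' ei ej; rewrite !mxE.
set x0 := tnth (in_tuple (xs1 ++ xs2)) i'.
set y0 := tnth (in_tuple (ys1 ++ ys2)) j'.
have -> : x0 = nth x0 (xs1 ++ xs2) i by rewrite ei nth_in_tuple.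
have -> : y0 = nth y0 (ys1 ++ ys2) j by rewrite ej nth_in_tuple.
have lti : (i < size (xs1 ++ xs2))%N by rewrite ei.
rewrite (nth_cat y0).
case: splitP => j1 ej1; rewrite ej1; rewrite castmxE mxE cast_ord_id.
- case: splitP => /= i1 ei1.
    (* the matrix on the left has full height: none of its rows is padding *)
    by have := ltn_ord i1; rewrite /=; lia.
  rewrite mxE (tnth_nth x0) (tnth_nth y0) /=.
  by congr (f (nth _ _ _) _); lia.
- rewrite /= addKn nth_cat.
  have lt2 : (j1 < size ys2)%N by [].
  case: splitP => /= i1 ei1.
    have lt1 : (i < size xs1)%N.
      by have := ltn_ord i1; rewrite /=; lia.
    by rewrite mxE lt1 f0 ?mem_nth.
  have -> : i = (size xs1 + i1)%N :> nat by rewrite ei1; lia.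
  rewrite ltnNge leq_addr addKn mxE.
  by rewrite (tnth_nth x0) (tnth_nth y0).
Qed.

End SeqMx.

(** * Sublists of given length in lexicographic order *)

Section Combs.
Variable T : eqType.
Implicit Types (s t : seq T) (r : nat).

Fixpoint combs s r : seq (seq T) :=
  match r, s with
  | 0, _ => [:: [::]]
  | r'.+1, [::] => [::]
  | r'.+1, x :: s' => map (cons x) (combs s' r') ++ combs s' r
  end.

Lemma size_combs s r : size (combs s r) = 'C(size s, r).
Proof.
elim: s r => [|x s IHs] [|r] //=.
by rewrite size_cat size_map !IHs binS addnC.
Qed.

Lemma mem_combs s r t :
  uniq s -> (t \in combs s r) = subseq t s && (size t == r).
Proof.
elim: s r t => [|x s IHs] [|r] t.
- by rewrite inE; case: t.
- by case: t.
- by rewrite inE; case: t => //= y t; rewrite andbF.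
case/andP=> xs us; rewrite /= mem_cat IHs //.
case: t => [|y t]; first by rewrite sub0seq orbF; apply/mapP => -[].
case: (eqVneq y x) => [->|nyx].
  rewrite mem_map => [|u v [] //]; rewrite IHs // eqSS.
  have -> : subseq (x :: t) s = false; last by rewrite orbF.
  by apply: contraNF xs => /mem_subseq; apply; rewrite mem_head.
suff -> : (y :: t \in map (cons x) (combs s r)) = false by [].
by apply/mapP => -[u _ [eyx]]; rewrite eyx eqxx in nyx.
Qed.

Lemma combs_uniq s r : uniq s -> uniq (combs s r).
Proof.
elim: s r => [|x s IHs] [|r] //= /andP[xs us].
rewrite cat_uniq map_inj_uniq => [|u v [] //]; rewrite !IHs // andbT /=.
apply/hasPn => t; rewrite mem_combs // => /andP[st _].
apply: contraNN xs => /mapP[u _ et].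
by apply: (mem_subseq st); rewrite et mem_head.
Qed.

Lemma combs_notin x s r t : uniq (x :: s) -> t \in combs s r -> x \notin t.
Proof.
case/andP=> xs us; rewrite mem_combs // => /andP[st _].
by apply: contra xs => /(mem_subseq st).
Qed.

Lemma all_mem_cons x t (u : seq T) :
  x \notin t -> all (mem (x :: u)) t = all (mem u) t.
Proof.
move=> xt; apply: eq_in_all => y yt; rewrite /= inE.
by case: eqVneq => // eyx; rewrite -eyx yt in xt.
Qed.

(** A sublist of a duplicate-free list is determined by its set of members. *)
Lemma combs_sub_eq s r t u :
  uniq s -> t \in combs s r -> u \in combs s r -> all (mem u) t = (t == u).
Proof.
move=> us; rewrite !mem_combs // => /andP[st /eqP et] /andP[su /eqP eu].
apply/idP/eqP => [/allP tu|->]; last exact/allP.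
have ut := subseq_uniq st us.
have [_ etu] := uniq_min_size ut tu (eq_leq (etrans eu (esym et))).
rewrite (subseq_uniqP us st) (subseq_uniqP us su).
by apply: eq_filter => x; rewrite /= etu.
Qed.

End Combs.

Lemma combs_sorted d (T : orderType d) (s : seq T) r :
  sorted <%O s ->
  sorted (fun t u => (t : seqlexi T) <= (u : seqlexi T))%O (combs s r).
Proof.
have trans : transitive (fun t u => (t : seqlexi T) <= (u : seqlexi T))%O.
  by move=> ? ? ?; apply: le_trans.
elim: s r => [|x s IHs] [|r] //= xs.
have us : uniq s by case/andP: (sorted_uniq lt_trans ltxx (xs : sorted _ (x :: s))).
rewrite (sorted_pairwise trans) pairwise_cat -!(sorted_pairwise trans).
rewrite !(IHs _ (path_sorted xs)) andbT; apply/andP; split; last first.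
  rewrite sorted_map; apply: sub_sorted (IHs r (path_sorted xs)) => t u letu.
  by rewrite /= lexi_cons lexx implyTb.
(* lists starting with the least element x precede those avoiding it *)
apply/allrelP => t u /mapP[t' _ ->]; rewrite mem_combs // => /andP[].
case: u => //= y u su _; rewrite lexi_cons.
have lxy : (x < y)%O.
  apply: (allP (order_path_min lt_trans xs)).
  by apply: (mem_subseq su); rewrite mem_head.
by rewrite (ltW lxy) (lt_geF lxy).
Qed.

(** Both sides are sorted for the same total order and list each r-subset
    once. *)
Lemma lex_subsets_combs n r :
  lex_subsets n r = [seq [set x in t] | t <- combs (enum 'I_n) r].
Proof.
have ue : uniq (enum 'I_n) by apply: enum_uniq.
have se : sorted <%O (enum 'I_n).
  have := iota_ltn_sorted 0 n; rewrite -val_enum_ord sorted_map.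
  by apply: sub_sorted.
have enumK t : t \in combs (enum 'I_n) r -> enum [set x in t] = t.
  rewrite mem_combs // => /andP[st _].
  rewrite [RHS](subseq_uniqP ue st) enumT /enum_mem.
  by apply: eq_filter => x; rewrite /= inE.
have lexT : transitive (@lex_le n) by move=> ? ? ?; apply: le_trans.
have lexA : antisymmetric (@lex_le n).
  move=> B C /le_anti eBC; apply/setP => x.
  by rewrite -mem_enum eBC mem_enum.
apply: (sorted_eq lexT lexA).
- by apply: sort_sorted => B C; apply: le_total.
- rewrite sorted_map.
  apply: (sub_in_sorted (P := [in combs (enum 'I_n) r])) (combs_sorted r se).
    by move=> t u ct cu; rewrite /= /lex_le !enumK.
  exact/allP.
rewrite /lex_subsets perm_sort; apply: uniq_perm.
- exact: enum_uniq.
- rewrite map_inj_in_uniq ?combs_uniq // => t u ct cu etu.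
  by rewrite -(enumK t ct) etu enumK.
move=> B; rewrite mem_enum inE; apply/idP/mapP => [cB|[t ct ->]].
  exists (enum B); last by apply/setP => x; rewrite inE mem_enum.
  by rewrite mem_combs // -cardE cB andbT enumT filter_subseq.
by rewrite cardE enumK //; move: ct; rewrite mem_combs // => /andP[].
Qed.

(** * The block recursion *)

Lemma Apq_rec (R : nzSemiRingType) p q :
  Apq R p.+1 q.+2 = opP2 (opO (Apq R p.+1 q.+1)) (Apq R p q.+2).
Proof.
rewrite -[LHS]/(opP [seq opO (Apq R r q.+1) | r <- rev (iota 1 p.+1)]).
have -> : iota 1 p.+1 = rcons (iota 1 p) p.+1.
  by rewrite -cats1 -(iotaD 1 p 1) addn1.
by rewrite rev_rcons.
Qed.

Section Incidence.
Variables (R : nzSemiRingType) (T : eqType).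

Definition incl_fun (t u : seq T) : R := (all (mem u) t)%:R.

(** The left half of the incidence matrix of [x :: s]: dropping [x] from rows
    that start with it gives the incidence matrix one rank lower, and
    [combs_sub_eq] makes the remaining rows an identity block. *)
Lemma incidence_head_block (x : T) s q : uniq (x :: s) ->
  opO (seqmx incl_fun (combs s q) (combs s q.+1))
    = seqmx incl_fun (combs (x :: s) q.+1) (map (cons x) (combs s q.+1)).
Proof.
move=> uxs; have /andP[_ us] := uxs.
pose f t u := incl_fun t (x :: u).
have -> : seqmx incl_fun (combs s q) (combs s q.+1)
        = seqmx f (map (cons x) (combs s q)) (combs s q.+1).
  rewrite -[X in _ = seqmx _ _ X]map_id seqmx_map.
  apply: eq_seqmx => t u ct _; rewrite /f /incl_fun /= mem_head /=.
  by rewrite all_mem_cons ?(combs_notin uxs ct).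
rewrite opO_seqmx ?combs_uniq //; last first.
  move=> t u ct cu; rewrite /f /incl_fun -(combs_sub_eq us ct cu).
  by rewrite all_mem_cons ?(combs_notin uxs ct).
by have := seqmx_map id (cons x) incl_fun (combs (x :: s) q.+1); rewrite map_id.
Qed.

(** The induction on the rank [q] is outermost, for all [p], because
    [incidence_head_block] lowers the rank while keeping [p], and the right half
    of the matrix keeps the rank while lowering [p]. *)
Lemma inclmx_combs p q (s : seq T) : uniq s -> size s = (p.+1 + q)%N ->
  seqmx incl_fun (combs s q) (combs s q.+1) = Apq R p.+1 q.+1.
Proof.
elim: q p s => [|q IHq] p s us szs.
  have -> : combs s 0 = [:: [::]] by case: s {us szs}.
  apply: eq_PMatrix => //; first by rewrite size_combs bin1 szs addn0.
  by move=> i j i' j' _ _; rewrite !mxE ord1.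
have combsS (x : T) s' r : combs (x :: s') r.+1
  = map (cons x) (combs s' r) ++ combs s' r.+1 by [].
elim: p s us szs => [|p IHp] [|x s] // uxs; have /andP[_ us] := uxs;
  rewrite addSn => -[szs]; rewrite Apq_rec -(IHq _ s) ?szs ?addnS //.
all: rewrite (incidence_head_block _ uxs) [combs (x :: s) q.+2]combsS.
  (* every column contains x, so the right half is empty, as is A_0^(q+2) *)
  have -> : combs s q.+2 = [::].
    by apply/size0nil; rewrite size_combs bin_small // szs.
  have -> : Apq R 0 q.+2 = seqmx incl_fun [::] [::].
    by apply: eq_PMatrix => // -[].
  by rewrite -[combs (x :: s) _]cats0 opP2_seqmx ?cats0.
rewrite -(IHp s) ?szs // combsS opP2_seqmx //.
move=> t u /mapP[t' _ ->] cu; rewrite /incl_fun /=.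
by rewrite (negbTE (combs_notin uxs cu)).
Qed.

End Incidence.

Local Close Scope ring_scope.

Theorem theorem5p6 (R : nzSemiRingType) (n k : nat) (hk : 2 <= k) (hkn : k <= n) :
  incidence_nk R n k = Apq R (n - (k - 2)./2) (k./2).
Proof.
have -> : (k./2 = ((k - 2)./2).+1)%N by lia.
have : ((k - 2)./2 < n)%N by lia.
rewrite /incidence_nk; have -> : (k./2 = ((k - 2)./2).+1)%N by lia.
move: (_./2) => q ltqn.
rewrite -[LHS]/(seqmx (fun B C : {set 'I_n} => ((B \subset C)%:R)%R)
                      (lex_subsets n q) (lex_subsets n q.+1)).
rewrite !lex_subsets_combs seqmx_map.
rewrite -[(n - q)%N]prednK ?subn_gt0 //.
rewrite -(@inclmx_combs R _ _ _ (enum 'I_n)) ?enum_uniq //; last first.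
  by rewrite size_enum_ord; lia.
apply: eq_seqmx => t u _ _; rewrite /incl_fun; congr (_%:R)%R; congr nat_of_bool.
apply/subsetP/allP => tu x; last by rewrite !inE; apply: tu.
by move=> xt; have := tu x; rewrite !inE; apply.
Qed.
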